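(* For every prime power $q$ and every positive integer $m$ there is a constant $C=C(q,m)$, independent of $n$, such that for all positive integers $n$ $$\left|E_n^{(m)}-\frac{mn}{m+1}\right|\le C,$$ i.e. $E_n^{(m)}=\frac{mn}{m+1}+O(1)$ where the implied constant depends only on $q$ and $m$.
   Context: Let $\mathbb{F}_q$ be the finite field with $q$ elements. An $m$-multisequence of length $n$ is an $m$-tuple $T=(S_1,\dots,S_m)$ of sequences $S_i=(s_{i,1},\dots,s_{i,n})\in\mathbb{F}_q^n$; the set of all of them is identified with $(\mathbb{F}_q^m)^n$ and has $q^{mn}$ elements. The joint linear complexity $L_n^{(m)}(T)$ is the least integer $L\ge 0$ such that there exist $c_1,\dots,c_L\in\mathbb{F}_q$ with $s_{i,j}=c_1s_{i,j-1}+\dots+c_Ls_{i,j-L}$ for all $1\le i\le m$ and all $L<j\le n$ (i.e. the length of the shortest linear feedback shift register simultaneously generating all $m$ sequences). The expected joint linear complexity is $E_n^{(m)}=q^{-nm}\sum_{T\in(\mathbb{F}_q^m)^n}L_n^{(m)}(T)$. *)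

(* Defs.v *)
From HB Require Import structures.
From mathcomp Require Import all_boot all_order all_algebra.

Set Implicit Arguments.
Unset Strict Implicit.
Unset Printing Implicit Defensive.

Import Order.TTheory GRing.Theory Num.Theory.
Local Open Scope ring_scope.

Definition prime_power (q : nat) : Prop :=
  exists p k : nat, [/\ prime p, (0 < k)%N & q = (p ^ k)%N].

(* The subtraction truncates at 0; below it is only relevant for k <= j. *)
Definition ord_back (n : nat) (j : 'I_n) (k : nat) : 'I_n :=
  Ordinal (leq_ltn_trans (leq_subr k j) (ltn_ord j)).

(* An m-multisequence of length n is a matrix T : 'M[F]_(m, n) whose rows are
   the sequences S_1, ..., S_m.  Indices start at 0, so that T i j is
   s_{i+1,j+1}, c k is c_{k+1}, and the condition L < j on 1-based positions
   reads L <= j. *)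
Definition generated_by_lfsr (F : finFieldType) (m n : nat)
    (T : 'M[F]_(m, n)) (L : nat) : bool :=
  [exists c : {ffun 'I_L -> F}, forall i : 'I_m, forall j : 'I_n,
     (L <= j)%N ==> (T i j == \sum_(k < L) c k * T i (ord_back j k.+1))].

Lemma generated_by_lfsr_ex (F : finFieldType) (m n : nat) (T : 'M[F]_(m, n)) :
  exists L : nat, generated_by_lfsr T L.
Proof.
exists n; apply/existsP; exists [ffun=> 0].
by apply/forallP=> i; apply/forallP=> j; rewrite leqNgt ltn_ord.
Qed.

Definition joint_linear_complexity (F : finFieldType) (m n : nat)
    (T : 'M[F]_(m, n)) : nat :=
  ex_minn (generated_by_lfsr_ex T).

Definition expected_joint_linear_complexity (F : finFieldType) (m n : nat)
    : rat :=
  ((#|F| ^ (n * m))%N)%:R^-1 *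
    \sum_(T : 'M[F]_(m, n)) (joint_linear_complexity T)%:R.

(* Main.v *)
(** Let J be the joint linear complexity and q = #|F|.  A multisequence with
    J <= L is determined by the L feedback coefficients and the m L initial
    terms, so P(J <= L) <= q^((m+1)L - mn).  Conversely the condition J <= L is
    the solvability of a linear system of m(n-L) equations in the L
    coefficients; if it is unsolvable, some nonzero row vector u annihilates its
    block Hankel matrix, which for a fixed u happens with probability q^(-L), so
    P(J > L) <= q^(mn - (m+1)L).  Both tails decay geometrically away from
    L = mn/(m+1), and E J is the sum over L < n of P(J > L). *)
Require Import Defs.
From HB Require Import structures.
From mathcomp Require Import all_boot all_order all_algebra.
From mathcomp Require Import zify lra.
Import Order.TTheory GRing.Theory Num.Theory.
Local Open Scope ring_scope.

Section Tails.
Set Implicit Arguments.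
Unset Strict Implicit.
Variables (F : finFieldType) (m : nat).

(** * Union bound, register lengths and the lower tail *)

Lemma card_bigcup_leq (I T : finType) (P : {pred I}) (A : I -> {set T}) k :
  (forall i, i \in P -> #|A i| <= k)%N ->
  (#|\bigcup_(i in P) A i| <= #|P| * k)%N.
Proof.
move=> leAk; rewrite -sum_nat_const.
elim/big_ind2: _ => [|b B c C leB leC|//]; first by rewrite cards0.
by rewrite (leq_trans (leq_card_setU B C)) ?leq_add.
Qed.

(** Padding the feedback coefficients with zeros keeps every relation, and fewer positions have to
    satisfy one. *)
Lemma generated_by_lfsr_leq n (T : 'M[F]_(m, n)) L L' :
  (L <= L')%N -> generated_by_lfsr T L -> generated_by_lfsr T L'.
Proof.
move=> leLL' /existsP[c /forallP genT]; apply/existsP.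
exists ([ffun k : 'I_L' => oapp (c : 'I_L -> F) 0 (insub (val k))]
  : {ffun 'I_L' -> F}).
apply/forallP=> i; apply/forallP=> j; apply/implyP=> leL'j.
move/forallP: (genT i) => /(_ j); rewrite (leq_trans leLL' leL'j) /= => /eqP ->.
apply/eqP; rewrite (bigID (fun k : 'I_L' => k < L)%N) /= [X in _ + X]big1 ?addr0.
  rewrite (big_ord_narrow leLL'); apply: eq_bigr => k _.
  by rewrite ffunE /= valK.
by move=> k nltkL; rewrite ffunE insubF ?mul0r //; apply: negbTE.
Qed.

Lemma leq_joint_linear_complexity n (T : 'M[F]_(m, n)) L :
  (joint_linear_complexity T <= L)%N = generated_by_lfsr T L.
Proof.
rewrite /joint_linear_complexity; case: ex_minnP => J genJ minJ.
by apply/idP/idP => [leJL|/minJ//]; apply: generated_by_lfsr_leq genJ.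
Qed.

Lemma joint_linear_complexity_leq n (T : 'M[F]_(m, n)) :
  (joint_linear_complexity T <= n)%N.
Proof.
rewrite leq_joint_linear_complexity; apply/existsP; exists [ffun=> 0].
by apply/forallP=> i; apply/forallP=> j; rewrite leqNgt ltn_ord.
Qed.

(** For fixed feedback coefficients, [T] is determined by its first [L] columns, by induction on the
    position; the union over the [#|F| ^ L] coefficient vectors adds [L] to the exponent. *)
Lemma card_generated_by_lfsr L d :
  (#|[set T : 'M[F]_(m, L + d) | generated_by_lfsr T L]| <= #|F| ^ (m.+1 * L))%N.
Proof.
pose gen (c : {ffun 'I_L -> F}) := [set T : 'M[F]_(m, L + d) |
  [forall i, forall j : 'I_(L + d),
    (L <= j)%N ==> (T i j == \sum_(k < L) c k * T i (ord_back j k.+1))]].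
have card_gen c : (#|gen c| <= #|F| ^ (m * L))%N.
  rewrite -(card_mx F m L) -(@card_in_imset _ _ lsubmx); first exact: max_card.
  move=> T T'; rewrite !inE => /forallP genT /forallP genT' eqTT'.
  apply/matrixP=> i j; have [p] := ubnP j; elim: p j => // p IHp j lejp.
  have [ltjL|leLj] := ltnP j L.
    have -> : j = lshift d (Ordinal ltjL) by apply: val_inj.
    by move/matrixP/(_ i (Ordinal ltjL)): eqTT'; rewrite !mxE.
  move/forallP: (genT i) => /(_ j); rewrite leLj /= => /eqP ->.
  move/forallP: (genT' i) => /(_ j); rewrite leLj /= => /eqP ->.
  by apply: eq_bigr => k _; rewrite IHp //=; have := ltn_ord k; lia.
have sub : [set T | generated_by_lfsr T L] \subset \bigcup_(c in predT) gen c.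
  apply/subsetP=> T; rewrite inE => /existsP[c genT].
  by apply/bigcupP; exists c; rewrite ?inE.
apply: leq_trans (subset_leq_card sub) _.
have /leq_trans-> // := card_bigcup_leq (P := predT) (fun c _ => card_gen c).
by rewrite card_ffun card_ord mulSn expnD.
Qed.

(** * The upper tail by duality *)

(* The left kernel of the block Hankel matrix whose k-th column lists, for all
   i and j, the value T i (L + j - (k + 1)). *)
Definition annihilates L d (u : 'M[F]_(m, d)) (T : 'M[F]_(m, L + d)) :=
  [forall k : 'I_L,
     \sum_i \sum_j u i j * T i (ord_back (rshift L j) k.+1) == 0].

(** If the rows of [H] span the whole space, the last [d] columns of [T] are a combination of them,
    whose coefficients serve as feedback. Otherwise the columns of [H] are dependent, and a
    dependency reshaped to an m by d matrix is [u]. *)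
Lemma not_generated_annihilates L d (T : 'M[F]_(m, L + d)) :
  ~~ generated_by_lfsr T L -> exists2 u : 'M[F]_(m, d), u != 0 & annihilates u T.
Proof.
pose H := \matrix_(k < L) mxvec (\matrix_(i < m, j < d)
            T i (ord_back (rshift L j) k.+1)).
case: (boolP (row_full H)) => [fullH|].
  case/negP; have /submxP[c Dc] := submx_full (mxvec (rsubmx T)) fullH.
  apply/existsP; exists ([ffun k => c 0 k] : {ffun 'I_L -> F}).
  apply/forallP=> i; apply/forallP=> j; apply/implyP=> leLj.
  have ltjLd : (j - L < d)%N by have := ltn_ord j; lia.
  have -> : j = rshift L (Ordinal ltjLd) by apply: val_inj; rewrite /= subnKC.
  move/rowP/(_ (mxvec_index i (Ordinal ltjLd))): Dc; rewrite mxvecE !mxE => ->.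
  by apply/eqP/eq_bigr => k _; rewrite ffunE mxE mxvecE mxE.
rewrite /row_full -mxrank_tr -/(row_free _) -kermx_eq0 => kerH _.
exists (vec_mx (nz_row (kermx H^T))).
  by rewrite vec_mx_eq0 nz_row_eq0.
have /sub_kermxP uH0 := nz_row_sub (kermx H^T).
apply/forallP=> k; apply/eqP; move/rowP/(_ k): uH0; rewrite !mxE.
apply: etrans; rewrite pair_big /= (reindex _ (curry_mxvec_bij m d)) /=.
by apply: eq_bigr => -[i j] _ /=; rewrite !mxE mxvecE mxE.
Qed.

(* As j0 is the last nonzero index of row i0 of u, the k-th kernel equation
   expresses the entry of T at (i0, L + j0 - (k + 1)) through entries at
   earlier positions of row i0 and entries of other rows. *)
Lemma annihilates_eq L d (u : 'M[F]_(m, d)) (T T' : 'M[F]_(m, L + d)) i0 j0 :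
    u i0 j0 != 0 -> (forall j, u i0 j != 0 -> (j <= j0)%N) ->
    annihilates u T -> annihilates u T' ->
    (forall i (p : 'I_(L + d)), ~~ [&& i == i0, j0 <= p & p < j0 + L]%N ->
       T i p = T' i p) ->
  T = T'.
Proof.
move=> u0 maxj0 /forallP annT /forallP annT' eqTT'.
apply/matrixP=> i p; have [b] := ubnP p; elim: b i p => // b IHb i p ltpb.
have [/and3P[/eqP-> lej0p ltp]|] := boolP [&& i == i0, j0 <= p & p < j0 + L]%N;
  last exact: eqTT'.
(* In the equation with this index, [u i0 j0] multiplies [T i0 p]: [j0 <= p] puts the index below
   [L], and [p < j0 + L] keeps the subtraction from truncating. *)
have ltk : (L + j0 - p.+1 < L)%N by lia.
have eqS := etrans (eqP (annT (Ordinal ltk))) (esym (eqP (annT' (Ordinal ltk)))).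
apply: (mulfI u0).
have Dp : ord_back (rshift L j0) (L + j0 - p.+1).+1 = p.
  by apply: val_inj => /=; lia.
move: eqS; rewrite (bigD1 i0) //= [RHS](bigD1 i0) //=.
rewrite (bigD1 j0) //= [in RHS](bigD1 j0) //= !Dp -!addrA.
set A := (X in _ + X = _); set B := (X in _ = _ + X).
suff -> : A = B by move/addIr.
congr (_ + _).
  apply: eq_bigr => j neqj; have [->|nzu] := eqVneq (u i0 j) 0.
    by rewrite !mul0r.
  rewrite IHb //=; have := maxj0 j nzu; move: neqj; rewrite -val_eqE /=; lia.
apply: eq_bigr => i' nei; apply: eq_bigr => j _.
by rewrite eqTT' // (negPf nei).
Qed.

(* Translating the kernel of u by the multisequences supported on the L
   positions j0, ..., j0 + L - 1 of row i0 is injective. *)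
Lemma card_annihilates L d (u : 'M[F]_(m, d)) : u != 0 ->
  (#|[set T : 'M[F]_(m, L + d) | annihilates u T]| * #|F| ^ L
     <= #|F| ^ (m * (L + d)))%N.
Proof.
move=> nzu; have /existsP[i0 /existsP[j1 nzu1]] : [exists i, exists j, u i j != 0].
  apply: contraNT nzu => /existsPn u0; apply/eqP/matrixP=> i j.
  by move/existsPn: (u0 i) => /(_ j); rewrite negbK mxE => /eqP.
have [j0 nzu0 maxj0] := @arg_maxnP _ j1 (fun j => u i0 j != 0) val nzu1.
pose E (w : 'rV[F]_L) : 'M[F]_(m, L + d) := \matrix_(i, p)
  if [&& i == i0, j0 <= p & p < j0 + L]%N then
    oapp (w 0) 0 (insub (p - j0)%N) else 0.
have in_E w (k : 'I_L) (p : 'I_(L + d)) : p = (j0 + k)%N :> nat -> E w i0 p = w 0 k.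
  move=> Dp; rewrite mxE eqxx Dp leq_addr ltn_add2l ltn_ord /=.
  by rewrite addKn valK.
have -> : (#|F| ^ L = #|[set: 'rV[F]_L]|)%N by rewrite cardsT card_mx mul1n.
rewrite -(card_mx F m) -cardsX.
rewrite -(@card_in_imset _ _ (fun x => x.1 + E x.2)); first exact: max_card.
move=> [T w] [T' w']; rewrite !inE !andbT /= => annT annT' eqTE.
(* Both translations vanish off the window, so [T] and [T'] agree there, and the kernel equations
   recover the window. *)
have eqT : T = T'.
  apply: (annihilates_eq nzu0 maxj0 annT annT') => i p /negPf out.
  by move/matrixP/(_ i p): eqTE; rewrite !mxE out !addr0.
rewrite eqT in eqTE *; move/addrI: eqTE => eqE; congr (_, _).
apply/rowP=> k; have ltp : (j0 + k < L + d)%N.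
  by have := ltn_ord k; have := ltn_ord j0; lia.
by rewrite -!(in_E _ k (Ordinal ltp)) ?eqE.
Qed.

Lemma card_not_generated_by_lfsr L d :
  (#|[set T : 'M[F]_(m, L + d) | ~~ generated_by_lfsr T L]| * #|F| ^ L
     <= #|F| ^ (m * d) * #|F| ^ (m * (L + d)))%N.
Proof.
have sub : [set T : 'M[F]_(m, L + d) | ~~ generated_by_lfsr T L] \subset
    \bigcup_(u in [set u : 'M[F]_(m, d) | u != 0]) [set T | annihilates u T].
  apply/subsetP=> T; rewrite inE => /not_generated_annihilates[u nzu annT].
  by apply/bigcupP; exists u; rewrite inE.
have cardF : (0 < #|F| ^ L)%N by rewrite expn_gt0 (ltnW (card_finNzRing_gt1 F)).
have leA (u : 'M[F]_(m, d)) : u \in [set u : 'M[F]_(m, d) | u != 0] ->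
    (#|[set T : 'M[F]_(m, L + d) | annihilates u T]|
       <= #|F| ^ (m * (L + d)) %/ #|F| ^ L)%N.
  by rewrite inE => nzu; rewrite leq_divRL // card_annihilates.
have leN := leq_trans (subset_leq_card sub) (card_bigcup_leq leA).
apply: leq_trans (leq_mul leN (leqnn _)) _; rewrite -mulnA.
by apply: leq_mul (leq_trunc_div _ _); rewrite -(card_mx F m d) max_card.
Qed.

(** A complexity, being at most [n], equals the number of [L < n] lying below it; then the two sums
    are exchanged. *)
Lemma sum_joint_linear_complexity n :
  (\sum_(T : 'M[F]_(m, n)) joint_linear_complexity T
     = \sum_(0 <= L < n) #|[set T : 'M[F]_(m, n) | ~~ generated_by_lfsr T L]|)%N.
Proof.
under [RHS]eq_bigr => L _ do rewrite -sum1dep_card big_mkcond.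
rewrite exchange_big; apply: eq_bigr => T _ /=.
under eq_bigr => L _ do rewrite -leq_joint_linear_complexity -ltnNge.
rewrite -big_mkcond sum1_count -[LHS](size_iota 0).
move: (joint_linear_complexity_leq T); move: (joint_linear_complexity T) => J.
move=> /subnKC<-; rewrite /index_iota subn0 iotaD count_cat add0n.
rewrite (eq_in_count (a2 := predT)); last by move=> L; rewrite mem_iota.
rewrite (eq_in_count (a2 := pred0) (s := iota J _)).
  by rewrite count_predT count_pred0 addn0.
by move=> L; rewrite mem_iota leqNgt => /andP[/negPf].
Qed.

End Tails.

(** * Summing the tails *)

Lemma sum_geometric_half_leq k : \sum_(0 <= i < k) 2^-1 ^+ i <= 2 :> rat.
Proof.
suff -> : \sum_(0 <= i < k) 2^-1 ^+ i = 2 - 2 * 2^-1 ^+ k :> rat.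
  by rewrite gerBl mulr_ge0 // exprn_ge0.
elim: k => [|k IHk]; first by rewrite big_nil expr0; lra.
by rewrite big_nat_recr //= IHk exprS; lra.
Qed.

(** With [p L] in the role of P(J > L), compare [p] with the step function that is 1 below [l] and 0
    from [l] on: the deficit below and the excess above are both dominated by geometric series. *)
Lemma sum_geometric_tails (p : nat -> rat) (a : rat) l n :
    (l <= n)%N -> 0 <= a -> (forall L, 0 <= p L <= 1) ->
    (forall k, (k < l)%N -> 1 - p (l - k.+1)%N <= 2^-1 ^+ k) ->
    (forall k, (l + k < n)%N -> p (l + k)%N <= a * 2^-1 ^+ k) ->
  - 2 <= \sum_(0 <= L < n) p L - l%:R <= 2 * a.
Proof.
move=> leln a0 p01 lo hi; rewrite (big_cat_nat (leq0n l) leln) //=.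
have sum_l : \sum_(0 <= L < l) p L = l%:R - \sum_(0 <= k < l) (1 - p (l - k.+1)%N).
  rewrite sumrB sumr_const_nat subn0 subKr big_nat_rev /=.
  by apply: eq_bigr => k _; rewrite add0n.
have lo0 : 0 <= \sum_(0 <= k < l) (1 - p (l - k.+1)%N).
  by apply: sumr_ge0 => k _; rewrite subr_ge0; case/andP: (p01 (l - k.+1)%N).
have lo2 : \sum_(0 <= k < l) (1 - p (l - k.+1)%N) <= 2.
  apply: le_trans (sum_geometric_half_leq l).
  by apply: ler_sum_nat => k /andP[_]; apply: lo.
have hi0 : 0 <= \sum_(l <= L < n) p L.
  by apply: sumr_ge0 => L _; case/andP: (p01 L).
have hi2 : \sum_(l <= L < n) p L <= a * 2.
  apply: le_trans (ler_wpM2l a0 (sum_geometric_half_leq (n - l))).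
  rewrite big_distrr -{1}[l]add0n big_addn; apply: ler_sum_nat => k /andP[_ ltk].
  by rewrite addnC hi // -ltn_subRL.
by rewrite sum_l; apply/andP; split; lra.
Qed.

Theorem theorem1 (q m : nat) (hq : prime_power q) (hm : (0 < m)%N) :
  exists C : rat, forall F : finFieldType, #|F| = q ->
    forall n : nat, (0 < n)%N ->
      `| expected_joint_linear_complexity F m n
         - (m * n)%N%:R / (m.+1)%:R | <= C.
Proof.
(* The lower side costs 2 for the tail and 1 for rounding mn/(m+1) down to [l]; the upper side costs
   [2 * q ^ m]. *)
exists (3 + 2 * (q ^ m)%:R) => F cardF n n_gt0.
have q_gt1 : (1 < q)%N by rewrite -cardF card_finNzRing_gt1.
have q_gt0 := ltnW q_gt1.
(* Since 2 <= q, decay at rate 1/q or faster is weakened to rate 1/2, which suits every field. *)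
have le2q a b c : (a + b <= c)%N -> (2 ^ a * q ^ b <= q ^ c)%N.
  move=> leabc; apply: leq_trans (leq_pexp2l q_gt0 leabc).
  by rewrite expnD leq_mul //; case: (a) => // a0; rewrite leq_exp2r.
pose N L := #|[set T : 'M[F]_(m, n) | ~~ generated_by_lfsr T L]|.
pose G L := #|[set T : 'M[F]_(m, n) | generated_by_lfsr T L]|.
pose Q := (q ^ (n * m))%N; pose l := ((m * n) %/ m.+1)%N.
have Q_gt0 : (0 < Q)%N by rewrite expn_gt0 q_gt0.
have Q0 : 0 < Q%:R :> rat by rewrite ltr0n.
have NG L : (N L + G L = Q)%N.
  rewrite /Q mulnC -cardF -card_mx -(cardsC [set T | generated_by_lfsr T L]) addnC.
  by congr (_ + _)%N; apply: eq_card => T; rewrite !inE.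
have lbound : (l * m.+1 <= m * n)%N := leq_trunc_div _ _.
have ubound : (m * n < l.+1 * m.+1)%N by rewrite -ltn_divLR.
have leln : (l <= n)%N by rewrite -(leq_pmul2r (ltn0Sn m)); nia.
have p01 L : 0 <= ((N L)%:R / Q%:R : rat) <= 1.
  rewrite divr_ge0 ?ler0n //= ler_pdivrMr // mul1r ler_nat.
  by rewrite -(NG L) leq_addr.
have lo k : (k < l)%N -> 1 - (N (l - k.+1)%N)%:R / Q%:R <= 2^-1 ^+ k :> rat.
  move=> ltkl; set L := (l - k.+1)%N.
  have leG : (G L <= q ^ (m.+1 * L))%N.
    have := card_generated_by_lfsr F m L (n - L).
    by rewrite subnKC ?cardF //; rewrite /L; lia.
  rewrite -[X in X - _](divff (lt0r_neq0 Q0)) -mulrBl -{1}(NG L).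
  rewrite natrD addrAC subrr add0r.
  rewrite ler_pdivrMr // exprVn ler_pdivlMl ?exprn_gt0 // -natrX -natrM ler_nat.
  apply: leq_trans (leq_mul (leqnn _) leG) _; apply: le2q.
  by rewrite /L; nia.
have hi k : (l + k < n)%N ->
    (N (l + k)%N)%:R / Q%:R <= (q ^ m)%:R * 2^-1 ^+ k :> rat.
  move=> ltn; set L := (l + k)%N.
  have leN : (N L * q ^ L <= q ^ (m * (n - L)) * Q)%N.
    have := card_not_generated_by_lfsr F m L (n - L).
    by rewrite subnKC ?cardF ?[(m * n)%N]mulnC //; rewrite /L; lia.
  rewrite ler_pdivrMr // exprVn mulrAC ler_pdivlMr ?exprn_gt0 //.
  rewrite -natrX -!natrM ler_nat.
  rewrite -(@leq_pmul2r (q ^ L)) ?expn_gt0 ?q_gt0 // mulnAC.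
  apply: leq_trans (leq_mul leN (leqnn _)) _.
  rewrite mulnAC [X in (_ <= X)%N]mulnAC leq_mul2r -expnD mulnC; apply/orP; right.
  (* The exponents require mn <= (m+1) l + m + mk. Rounding down to [l] loses at most m, which the
     factor [q ^ m] absorbs. *)
  by apply: le2q; rewrite /L; nia.
have E : expected_joint_linear_complexity F m n
    = \sum_(0 <= L < n) (N L)%:R / Q%:R.
  rewrite /expected_joint_linear_complexity cardF -natr_sum.
  by rewrite sum_joint_linear_complexity natr_sum mulrC mulr_suml.
have := sum_geometric_tails leln (ler0n _ (q ^ m)) p01 lo hi.
rewrite -E => /andP[Elo Ehi].
have m0 : 0 < m.+1%:R :> rat by rewrite ltr0n.
have flo : l%:R <= (m * n)%:R / m.+1%:R :> rat.
  by rewrite ler_pdivlMr // -natrM ler_nat.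
have fhi : (m * n)%:R / m.+1%:R <= l%:R + 1 :> rat.
  by rewrite ler_pdivrMr // natr1 -natrM ler_nat ltnW.
have qm0 : 0 <= (q ^ m)%:R :> rat := ler0n _ _.
move: (_ / _) flo fhi => f *.
by rewrite ler_norml; apply/andP; split; lra.
Qed.
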